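(* Let $d\ge1$ and $p\ge1$. There is a constant $C=C(p,d)>0$ such that for every bounded open set $\Omega\subset\mathbb{R}^d$ and all constants $m,m'>0$, $$Wb_\Omega^p(m,m')\le C\,\mathrm{diam}(\Omega)^{p+d}\,\frac{|m-m'|^p}{\max(m,m')^{p-1}} .$$
   Context: Boundary Wasserstein distance: for a bounded open set $\Omega\subset\mathbb{R}^d$ and positive finite measures $\mu,\lambda$ on $\Omega$ (possibly of different mass), $Wb_\Omega^p(\mu,\lambda)$ is the minimum of $\int_{\overline\Omega\times\overline\Omega}|x-y|^pd\pi(x,y)$ over positive measures $\pi$ on $\overline\Omega\times\overline\Omega$ whose first and second marginals, restricted to $\Omega$, equal $\mu$ and $\lambda$ respectively. Here the constants $m,m'$ stand for the measures on $\Omega$ with constant Lebesgue density $m$, respectively $m'$. *)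

(* Defs.v *)
From HB Require Import structures.
From mathcomp Require Import all_boot all_order all_algebra.
From mathcomp Require Import all_classical all_reals all_analysis.
From mathcomp Require Import measurable_realfun.

Set Implicit Arguments.
Unset Strict Implicit.
Unset Printing Implicit Defensive.

Import Order.TTheory GRing.Theory Num.Theory.
Import numFieldNormedType.Exports.

Local Open Scope classical_set_scope.
Local Open Scope ring_scope.

(* The library has no sigma-algebra on matrices: 'rV[R]_d gets the Borel one. *)
HB.instance Definition _ (R : realType) (d : nat) :=
  @isMeasurable.Build (sigma_display (open : set (set 'rV[R]_d))) 'rV[R]_d
    <<s (open : set (set 'rV[R]_d)) >> (@sigma_algebra0 _ setT _) (@sigma_algebraC _ _)
    (@sigma_algebra_bigcup _ setT _).

Section borel_rV.
Variables (R : realType) (d : nat).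

Lemma open_measurable_rV (U : set 'rV[R]_d) : open U -> measurable U.
Proof. by move=> oU; apply: sub_sigma_algebra. Qed.

Lemma measurable_rV_coord (i : 'I_d) :
  measurable_fun setT (fun v : 'rV[R]_d => v ord0 i).
Proof.
apply: (measurability _ (RGenOInfty.measurableE R)).
move=> _ [_ [a ->] <-].
rewrite setTI; apply: open_measurable_rV; apply: open_comp.
  by move=> v _; exact: coord_continuous.
by rewrite set_itvE; exact: open_gt.
Qed.

Let qball (q : 'rV[rat]_d * nat) : set 'rV[R]_d :=
  ball (map_mx ratr q.1 : 'rV[R]_d) (q.2.+1%:R^-1 : R).

Let open_rV_bigcup (U : set 'rV[R]_d) : open U ->
  U = \bigcup_(q in [set q | qball q `<=` U]) qball q.
Proof.
move=> oU; apply/seteqP; split; last by move=> v [q /= qU qv]; exact: qU.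
move=> v Uv.
have /nbhs_ballP[e /= e0 eU] : nbhs v U by exact: open_nbhs_nbhs.
have [k ke] : exists k, (k.+1%:R^-1 : R) < e / 2.
  have [k _ /(_ _ (leqnn k)) H] :=
    near_infty_natSinv_lt (PosNum (divr_gt0 e0 (ltr0n R 2))).
  by exists k.
have rq (i : 'I_d) : exists q : rat, `|v ord0 i - ratr q| < k.+1%:R^-1.
  have [|q] := @rat_in_itvoo R (v ord0 i) (v ord0 i + k.+1%:R^-1).
    by rewrite ltrDl invr_gt0.
  rewrite in_itv/= => /andP[q1 q2]; exists q.
  by rewrite distrC gtr0_norm ?subr_gt0// ltrBlDl.
have [f fP] := choice rq.
have k0 : 0 < k.+1%:R^-1 :> R by rewrite invr_gt0.
exists (\row_i f i, k) => /=.
  move=> w [_ /= wq]; apply: eU; split => // i j.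
  apply: (@le_ball _ _ _ (k.+1%:R^-1 + k.+1%:R^-1)).
    by rewrite (splitr e) lerD// ltW.
  apply: ball_triangle (wq i j).
  by rewrite /ball/= !mxE ord1.
split => // i j; apply: ball_sym.
by rewrite /ball/= !mxE ord1.
Qed.

Lemma measurable_fun_rV (e : measure_display) (T : measurableType e)
    (f : T -> 'rV[R]_d) :
  (forall i, measurable_fun setT (fun x => f x ord0 i)) ->
  measurable_fun setT f.
Proof.
move=> mf.
apply: (@measurability _ _ _ _ _ _ (@open 'rV[R]_d)) => // _ [U oU <-].
rewrite setTI (open_rV_bigcup oU) preimage_bigcup bigcup_mkcond.
apply: countable_bigcupT_measurable => // -[q k]; case: ifP => // _.
rewrite (_ : _ @^-1` _ = \bigcap_(i in [set: 'I_d])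
    ([set: T] `&` (fun x => f x ord0 i) @^-1`
       ball (ratr (q ord0 i) : R) (k.+1%:R^-1 : R))).
  apply: fin_bigcap_measurable => // i _; apply: mf => //.
  exact: measurable_ball.
apply/seteqP; split => [x [_ /= fx] i _|x fx]; split => //.
  by have := fx ord0 i; rewrite mxE.
by move=> j i; rewrite mxE ord1; have [] := fx i Logic.I.
Qed.

Lemma measurable_rV_box (A : 'I_d -> set R) :
  (forall i, measurable (A i)) ->
  measurable [set v : 'rV[R]_d | forall i, A i (v ord0 i)].
Proof.
move=> mA.
rewrite (_ : mkset _ = \bigcap_(i in [set: 'I_d])
    ([set: _] `&` (fun v : 'rV[R]_d => v ord0 i) @^-1` A i)).
  apply: fin_bigcap_measurable => // i _.
  exact: measurable_rV_coord.
apply/seteqP; split => [v /= H i _|v H i]; first by split.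
by have [] := H i Logic.I.
Qed.

End borel_rV.

Section lebesgue_rV_step.
Local Open Scope ereal_scope.
Variables (R : realType) (d : nat).
Variable mu : {sigma_finite_measure set 'rV[R]_d -> \bar R}.

Definition cons_rV (z : R * 'rV[R]_d) : 'rV[R]_d.+1 :=
  \row_i (if unlift ord0 i is Some j then z.2 ord0 j else z.1).

Lemma cons_rV0 z : cons_rV z ord0 ord0 = z.1.
Proof. by rewrite mxE unlift_none. Qed.

Lemma cons_rVS z i : cons_rV z ord0 (lift ord0 i) = z.2 ord0 i.
Proof. by rewrite mxE liftK. Qed.

Lemma measurable_cons_rV : measurable_fun setT cons_rV.
Proof.
apply: measurable_fun_rV => i; have [j ->|->] := unliftP ord0 i.
  under eq_fun do rewrite cons_rVS.
  exact: (measurableT_comp (measurable_rV_coord j) measurable_snd).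
under eq_fun do rewrite cons_rV0.
exact: measurable_fst.
Qed.

Let uncons_rV (v : 'rV[R]_d.+1) : R * 'rV[R]_d :=
  (v ord0 ord0, \row_j v ord0 (lift ord0 j)).

Let measurable_uncons_rV : measurable_fun setT uncons_rV.
Proof.
apply: measurable_fun_pair; first exact: measurable_rV_coord.
apply: measurable_fun_rV => i; under eq_fun do rewrite mxE.
exact: measurable_rV_coord.
Qed.

Let cons_rVK : cancel cons_rV uncons_rV.
Proof.
move=> -[x v]; rewrite /uncons_rV cons_rV0; congr pair.
by apply/rowP => i; rewrite mxE cons_rVS.
Qed.

Definition lebesgue_rV_step : set 'rV[R]_d.+1 -> \bar R :=
  pushforward (@lebesgue_measure R \x mu) cons_rV.

Local Notation step := lebesgue_rV_step.

Let step0 : step set0 = 0.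
Proof. by rewrite /step /pushforward preimage_set0 measure0. Qed.

Let step_ge0 A : 0 <= step A.
Proof. by rewrite /step /pushforward measure_ge0. Qed.

Let step_sigma_additive : semi_sigma_additive step.
Proof.
apply: measure_semi_sigma_additive.
exact: measurable_cons_rV.
Qed.

HB.instance Definition _ := isMeasure.Build _ _ _ step
  step0 step_ge0 step_sigma_additive.

Let step_sigma_finite : sigma_finite setT step.
Proof.
have /sigma_finiteP[F [TF ndF Foo]] := sigma_finiteT (@lebesgue_measure R).
have /sigma_finiteP[G [TG ndG Goo]] := sigma_finiteT mu.
exists (fun n => uncons_rV @^-1` (F n `*` G n)).
  apply/seteqP; split => // v _.
  have [n _ Fn] : (\bigcup_i F i) (uncons_rV v).1 by rewrite -TF.
  have [k _ Gk] : (\bigcup_i G i) (uncons_rV v).2 by rewrite -TG.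
  exists (maxn n k) => //; split.
    by move: Fn; exact/subsetPset/ndF/leq_maxl.
  by move: Gk; exact/subsetPset/ndG/leq_maxr.
move=> n; have [mF Fy] := Foo n; have [mG Gy] := Goo n; split.
  rewrite -[X in measurable X]setTI; apply: measurable_uncons_rV => //.
  exact: measurableX.
rewrite /step /pushforward -comp_preimage.
rewrite (_ : _ \o _ = id) ?preimage_id; last exact/funext.
by rewrite product_measure1E// lte_mul_pinfty// ge0_fin_numE.
Qed.

HB.instance Definition _ := Measure_isSigmaFinite.Build _ _ _ step
  step_sigma_finite.

End lebesgue_rV_step.

(* d-dimensional Lebesgue measure, as an iterated product measure. *)
Fixpoint lebesgue_rV (R : realType) (d : nat) :
    {sigma_finite_measure set 'rV[R]_d -> \bar R} :=
  match d with
  | 0 => \d_(0 : 'rV[R]_0)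
  | d'.+1 => lebesgue_rV_step (lebesgue_rV R d')
  end.

Lemma lebesgue_rV_box (R : realType) (d : nat) (A : 'I_d -> set R) :
  (forall i, measurable (A i)) ->
  lebesgue_rV R d [set v | forall i, A i (v ord0 i)] =
    (\prod_(i < d) lebesgue_measure (A i))%E.
Proof.
elim: d A => [|d IH] A mA.
  by rewrite big_ord0 /= diracE mem_set// => -[].
rewrite big_ord_recl -IH//.
have mB := @measurable_rV_box R d _ (fun i => mA (lift ord0 i)).
refine (eq_trans _ (product_measure1E (@lebesgue_measure R)
  (lebesgue_rV R d) (mA ord0) mB)).
apply: (congr1 (product_measure1 _ _)).
apply/seteqP; split => [z /= H|z [/= H0 H] i].
  by split => [|i /=]; [rewrite -cons_rV0|rewrite -cons_rVS]; exact: H.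
by have [j ->|->] := unliftP ord0 i; rewrite ?cons_rVS ?cons_rV0.
Qed.

(* The norm of 'rV[R]_d in the library is the sup norm; the cost and the
   diameter are Euclidean. *)
Definition eucl_norm (R : realType) (d : nat) (v : 'rV[R]_d) : R :=
  Num.sqrt (\sum_(i < d) v ord0 i ^+ 2).

Definition diam (R : realType) (d : nat) (A : set 'rV[R]_d) : R :=
  sup [set eucl_norm (x - y) | x in A & y in A].

(* The measure on Omega with constant Lebesgue density m, extended by 0. *)
Definition constant_density (R : realType) (d : nat) (Omega : set 'rV[R]_d)
    (oOmega : open Omega) (m : {nonneg R}) :
    {measure set 'rV[R]_d -> \bar R} :=
  mscale m (mrestr (lebesgue_rV R d) (open_measurable_rV oOmega)).

Section boundary_wasserstein.
Local Open Scope ereal_scope.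
Variables (R : realType) (d : nat).
Implicit Types Omega : set 'rV[R]_d.
Implicit Types mu lambda : {measure set 'rV[R]_d -> \bar R}.
Implicit Types pi : {measure set ('rV[R]_d * 'rV[R]_d) -> \bar R}.

(* A measure on closure Omega x closure Omega is a measure on the whole space
   that does not charge the complement. Nothing is asked of the marginals on
   the boundary of Omega. *)
Definition boundary_plan Omega mu lambda pi : Prop :=
  [/\ pi (~` (closure Omega `*` closure Omega)) = 0,
      forall A, measurable A -> A `<=` Omega -> pushforward pi fst A = mu A &
      forall A, measurable A -> A `<=` Omega -> pushforward pi snd A = lambda A].

Definition transport_cost (p : R) Omega pi : \bar R :=
  \int[pi]_(z in closure Omega `*` closure Omega)
    ((eucl_norm (z.1 - z.2)%R) `^ p)%R%:E.

(* The p-th power of the distance, i.e. the optimal cost itself. The minimum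
   over plans is written as an infimum, which needs no proof of attainment. *)
Definition Wb_pow (p : R) Omega mu lambda : \bar R :=
  ereal_inf [set transport_cost p Omega pi |
             pi in [set pi | boundary_plan Omega mu lambda pi]].

End boundary_wasserstein.

(* Main.v *)
(** Scale one coordinate about a point of Omega by the factor s = m/m', so that
    the map T pushes the density m on the whole space to the density m'. Keep
    the mass whose start x or arrival T x lies in Omega, and when one of the two
    endpoints lies outside, replace it by a boundary point of Omega at distance
    at most 2 |x - T x| from the other one: the boundary is free, so both
    marginals on Omega are right.
    If D is the diameter, the displacement is at most a constant times
    D min(1, |m - m'| / min(m, m')), hence at most a constant times
    D |m - m'| / max(m, m'), and the mass moved is at most (m + m') |Omega|.
    Stretching, instead of sending the excess mass straight to the boundary,
    is what gives the factor |m - m'|^p rather than |m - m'|. *)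
Require Import Defs.
From mathcomp Require Import all_boot all_order all_algebra.
From mathcomp Require Import all_classical all_reals all_analysis.
From mathcomp Require Import measurable_realfun ring lra.

Import Order.TTheory GRing.Theory Num.Theory.
Import numFieldNormedType.Exports.

Local Open Scope classical_set_scope.
Local Open Scope ring_scope.

(** * Sup norm against Euclidean norm and diameter *)

Section sup_norm.
Variables (R : realType) (d : nat).
Implicit Types (v x y : 'rV[R]_d) (c : R).

Lemma norm_coord_le v i : `|v ord0 i| <= `|v|.
Proof.
rewrite [leRHS]/Num.norm/= mx_normrE.
by apply/bigmax_geP; right; exists (ord0, i).
Qed.

Lemma rV_norm_le v c : 0 <= c -> (forall i, `|v ord0 i| <= c) -> `|v| <= c.
Proof.
move=> c0 vc; rewrite [leLHS]/Num.norm/= mx_normrE.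
by apply/bigmax_leP; split => //= -[i j] _ /=; rewrite ord1.
Qed.

Lemma eucl_norm_le v : eucl_norm v <= Num.sqrt d%:R * `|v|.
Proof.
rewrite -[`|v|]ger0_norm// -sqrtr_sqr -sqrtrM//.
apply: ler_wsqrtr.
have -> : d%:R * `|v| ^+ 2 = \sum_(i < d) `|v| ^+ 2.
  by rewrite sumr_const card_ord mulr_natl.
apply: ler_sum => i _; rewrite -real_normK ?num_real//.
by rewrite lerXn2r ?nnegrE ?norm_coord_le.
Qed.

Lemma norm_le_eucl_norm v : `|v| <= eucl_norm v.
Proof.
apply: rV_norm_le => [|i]; first exact: sqrtr_ge0.
rewrite -sqrtr_sqr; apply: ler_wsqrtr.
by rewrite (bigD1 i)//= lerDl sumr_ge0// => j _; rewrite sqr_ge0.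
Qed.

Lemma norm_le_diam (A : set 'rV[R]_d) x y :
  bounded_set A -> A x -> A y -> `|x - y| <= diam A.
Proof.
move=> [M [_ AM]] Ax Ay; apply: le_trans (norm_le_eucl_norm _) _.
apply: ub_le_sup; last by exists x => //; exists y.
(* This witness shows that the distances are bounded above, without which [sup] would only be a
   default value. *)
exists (Num.sqrt d%:R * ((M + 1) + (M + 1))) => _ [u Au [w Aw <-]].
have bnd z : A z -> `|z| <= M + 1 by apply: AM; rewrite ltrDl.
apply: le_trans (eucl_norm_le _) _; rewrite ler_wpM2l ?sqrtr_ge0//.
by rewrite (le_trans (ler_normB _ _))// lerD// bnd.
Qed.

End sup_norm.

(* The measure structure on [pushforward] depends on a measurability proof that
   unification does not find; here that proof is an argument. *)
Definition image_measure {d1 d2 : measure_display} {T1 : measurableType d1}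
    {T2 : measurableType d2} {R : realType} (mu : {measure set T1 -> \bar R})
    {f : T1 -> T2} (mf : measurable_fun setT f) : {measure set T2 -> \bar R} :=
  measure_function_pushforward__canonical__measure_function_Measure mu mf.

(** * Lebesgue measure under scaling of one coordinate *)

Section stretch.
Variable R : realType.

(** By uniqueness of Lebesgue measure: [s] times the pushforward gives half-open intervals their
    length. *)
Lemma lebesgue_measure_affine (a s : R) (A : set R) : 0 < s -> measurable A ->
  lebesgue_measure ((fun t => a + s * (t - a)) @^-1` A) =
    (s^-1%:E * lebesgue_measure A)%E.
Proof.
move=> s0 mA; 
pose f (t : measurableTypeR R) : measurableTypeR R := a + s * (t - a).
have mf : measurable_fun setT f.
  apply: measurable_funD => //; apply: measurable_funM => //.
  exact: measurable_funB.
have sE : (s^-1%:E * s%:E = 1 :> \bar R)%E by rewrite -EFinM mulVf ?gt_eqF.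
pose nu := mscale (NngNum (ltW s0)) (image_measure lebesgue_measure mf).
have nuE B : nu B = (s%:E * lebesgue_measure (f @^-1` B))%E by [].
suff -> : lebesgue_measure A = nu A.
  by rewrite nuE muleA sE mul1e.
apply: lebesgue_measure_unique mA => _ [[x y] _ <-].
rewrite -[RHS]/(nu _) nuE.
have -> : f @^-1` [set` `]x, y]] =
    `]a + s^-1 * (x - a), a + s^-1 * (y - a)]%classic.
  apply/funext => t; apply/propext; rewrite /= !in_itv/= /f.
  rewrite -(ltrBlDl x) -(lerBrDl _ y) -(ltrBrDl _ t) -(lerBlDl t).
  by rewrite ltr_pdivrMl// ler_pdivlMl.
rewrite !lebesgue_measure_itv/= !lte_fin ltrD2l ltr_pM2l ?invr_gt0// ltrD2r.
case: ifP => _; last by rewrite mule0.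
rewrite -!EFinB -EFinM; congr EFin; field.
by rewrite gt_eqF.
Qed.


Variable d : nat.

(** Scaling a single coordinate has Jacobian [s] itself, so a ratio of densities is matched without
    taking a root depending on the dimension. *)
Definition stretch (a s : R) (v : 'rV[R]_d.+1) : 'rV[R]_d.+1 :=
  \row_i (if i == ord0 then a + s * (v ord0 ord0 - a) else v ord0 i).

Lemma measurable_stretch (a s : R) : measurable_fun setT (stretch a s).
Proof.
apply: measurable_fun_rV => i; under eq_fun do rewrite mxE.
have m0 := @measurable_rV_coord R d.+1.
case: (i == ord0); last exact: m0.
apply: measurable_funD => //; apply: measurable_funM => //.
exact: measurable_funB.
Qed.

(** In the coordinates of [cons_rV] the stretch acts on the first factor alone, so uniqueness of the
    product measure reduces the claim to rectangles, where the one-dimensional case applies. *)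
Lemma lebesgue_rV_stretch (a s : R) (A : set 'rV[R]_d.+1) :
  0 < s -> measurable A ->
  lebesgue_rV R d.+1 (stretch a s @^-1` A) =
    (s^-1%:E * lebesgue_rV R d.+1 A)%E.
Proof.
move=> s0 mA; set mu := lebesgue_rV R d.
pose psi (t : measurableTypeR R) : measurableTypeR R := a + s * (t - a).
pose f (z : measurableTypeR R * 'rV[R]_d) := (psi z.1, z.2).
have mpsi : measurable_fun setT psi.
  apply: measurable_funD => //; apply: measurable_funM => //.
  exact: measurable_funB.
have mf : measurable_fun setT f.
  apply: measurable_fun_pair => //.
  exact: measurableT_comp mpsi measurable_fst.
have sE : (s^-1%:E * s%:E = 1 :> \bar R)%E by rewrite -EFinM mulVf ?gt_eqF.
pose nu := mscale (NngNum (ltW s0))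
  (image_measure (lebesgue_measure \x mu)%E mf).
have nuE B : nu B = (s%:E * (lebesgue_measure \x mu)%E (f @^-1` B))%E by [].
have stretchE z : stretch a s (cons_rV z) = cons_rV (f z).
  apply/rowP => i; rewrite mxE.
  have [j ->|->] := unliftP ord0 i; first by rewrite !cons_rVS.
  by rewrite eqxx !cons_rV0.
have preE : @cons_rV R d @^-1` (stretch a s @^-1` A) =
    f @^-1` (@cons_rV R d @^-1` A).
  by apply/seteqP; split => z /=; rewrite stretchE.
have mcA : measurable (@cons_rV R d @^-1` A).
  by rewrite -[X in measurable X]setTI; exact: measurable_cons_rV.
have -> : lebesgue_rV R d.+1 A = nu (@cons_rV R d @^-1` A).
  apply: (@product_measure_unique _ _ _ _ _ _ _ nu) mcA => B C mB mC.
  rewrite -[LHS]/(nu _) nuE.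
  have -> : f @^-1` (B `*` C) = (psi @^-1` B) `*` C by [].
  have mpB : measurable (psi @^-1` B).
    by rewrite -[X in measurable X]setTI; exact: mpsi.
  transitivity (s%:E * (lebesgue_measure (psi @^-1` B) * mu C))%E.
    congr mule; exact: product_measure1E.
  rewrite [lebesgue_measure _](lebesgue_measure_affine a s B s0 mB).
  rewrite !muleA [(s%:E * _)%E]muleC sE mul1e.
  by [].
by rewrite nuE muleA sE mul1e -preE.
Qed.

End stretch.

(** The set lies in a closed sup-norm ball, which is a box with all sides [2 * r]. *)
Lemma lebesgue_rV_le_cube (R : realType) (d : nat) (x : 'rV[R]_d) (r : R)
    (A : set 'rV[R]_d) : 0 <= r -> measurable A ->
  (forall y, A y -> `|y - x| <= r) ->
  (lebesgue_rV R d A <= ((2 * r) ^+ d)%:E)%E.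
Proof.
move=> r0 mA Ax.
pose I (i : 'I_d) : set R := `[x ord0 i - r, x ord0 i + r]%classic.
have mI i : measurable (I i) by exact: measurable_itv.
apply: (@le_trans _ _ (lebesgue_rV R d [set v | forall i, I i (v ord0 i)])).
  apply: le_measure; rewrite ?inE//; first exact: measurable_rV_box.
  move=> y /Ax yx i; rewrite /I/= in_itv/= -ler_distl.
  by have := norm_coord_le _ _ (y - x) i; rewrite !mxE => /le_trans; apply.
rewrite lebesgue_rV_box// (eq_bigr (fun=> (2 * r)%:E)); last first.
  move=> i _; rewrite /I lebesgue_measure_itv/= lte_fin.
  case: ifPn => [_|]; first by rewrite -EFinB; congr EFin; ring.
  (* Here [r] is 0 and the interval is a point, of measure [0 = 2 * r]. *)
  rewrite -leNgt => ?; congr EFin; lra.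
by rewrite prodEFin prodr_const card_ord.
Qed.

(** * Boundary points and their measurable selection *)

Section boundary.
Variables (R : realType) (d : nat).
Implicit Types (U B : set 'rV[R]_d) (x y c : 'rV[R]_d).

Lemma continuous_dist_rV c : continuous (fun x : 'rV[R]_d => `|x - c|).
Proof.
move=> x; have Fx : Filter (nbhs (x : 'rV[R]_d)) by exact: nbhs_filter.
apply: (@cvg_norm R 'rV[R]_d _ _ Fx (fun x => x - c)).
apply: (@cvgB R 'rV[R]_d _ _ Fx id (cst c) x c); first exact: cvg_id.
exact: cvg_cst.
Qed.

Lemma measurable_dist_rV c :
  measurable_fun setT (fun x : 'rV[R]_d => `|x - c|).
Proof.
apply: (measurability _ (RGenOInfty.measurableE R)).
move=> _ [_ [a ->] <-]; rewrite setTI; apply: open_measurable_rV.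
apply: open_comp; last by rewrite set_itvE; exact: open_gt.
by move=> x _; exact: continuous_dist_rV.
Qed.

Lemma closure_norm_le U x (D : R) :
  (forall y, U y -> `|y - x| <= D) -> forall y, closure U y -> `|y - x| <= D.
Proof.
move=> Ux; pose K := (fun y : 'rV[R]_d => `|y - x|) @^-1` [set t | t <= D].
have cK : closed K.
  apply: preimage_closed; last exact: closed_le.
  by move=> ? _; exact: continuous_dist_rV.
by move=> y /(closure_subset Ux); rewrite -(proj1 (closure_id K) cK).
Qed.

Lemma measurable_eucl_dist_powR (p : R) :
  measurable_fun setT
    (fun z : 'rV[R]_d * 'rV[R]_d => (eucl_norm (z.1 - z.2)) `^ p).
Proof.
apply: (measurableT_comp (measurable_powR p)).
apply: (eq_measurable_fun (fun z : 'rV[R]_d * 'rV[R]_d =>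
    (\sum_(i < d) (z.1 - z.2) ord0 i ^+ 2) `^ 2^-1)).
  move=> z _; rewrite /eucl_norm powR12_sqrt// sumr_ge0// => i _.
  exact: sqr_ge0.
apply: (measurableT_comp (measurable_powR 2^-1)).
apply: measurable_sum => i; apply: measurable_funX.
under eq_fun do rewrite !mxE.
by apply: measurable_funB;
  apply: (measurableT_comp (measurable_rV_coord i)).
Qed.

(** A segment is connected: without a boundary point on it, its part in [U] would be relatively
    open, closed and nonempty, hence the whole segment, although [y] lies outside [U]. *)
Lemma exists_boundary_point U x y : open U -> U x -> ~ U y ->
  exists2 c, (closure U `\` U) c & `|x - c| <= `|x - y|.
Proof.
move=> oU Ux nUy; apply: contrapT => nc.
pose f (t : R) : 'rV[R]_d := x + t *: (y - x).
have cf : continuous f.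
  by move=> t; apply: cvgD; [exact: cvg_cst|apply: cvgZl; exact: cvg_id].
have ftle t : `[0, 1]%classic t -> `|x - f t| <= `|x - y|.
  rewrite /= in_itv/= => /andP[t0 t1].
  rewrite opprD addrA subrr add0r normrN normrZ ger0_norm// distrC.
  by rewrite ler_piMl.
pose A : set R := `[0, 1]%classic.
have : A `&` f @^-1` U = A.
  apply: (@segment_connected R 0 1).
  - exists 0; split; first by rewrite /A/= in_itv/= lexx ler01.
    by rewrite /= /f scale0r addr0.
  - by exists (f @^-1` U) => //; exact: open_comp.
  - exists (f @^-1` closure U).
      by apply: preimage_closed; [move=> ? _; exact: cf|exact: closed_closure].
    apply/seteqP; split => t [At ft]; split => //; first exact: subset_closure.
    by apply: contrapT => nft; apply: nc; exists (f t); [split|exact: ftle].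
move=> /seteqP[_ /(_ 1)]; case => //=.
  by rewrite /A/= in_itv/= lexx ler01.
by move=> _; rewrite /f scale1r addrCA subrr addr0.
Qed.

(** In each ball with rational centre and radius [1 / (k + 1)] that meets [B], one point of [B] is
    chosen; balls that miss [B] get the default [b0]. *)
Lemma rV_separable B : B !=set0 ->
  exists2 b : nat -> 'rV[R]_d, (forall n, B (b n)) &
    forall c e, B c -> 0 < e -> exists n, `|c - b n| < e.
Proof.
move=> [b0 Bb0].
pose Q := ('rV[rat]_d * nat)%type.
pose S (q : Q) : set 'rV[R]_d :=
  [set b | B b /\ `|map_mx ratr q.1 - b| < q.2.+1%:R^-1].
pose b n := if unpickle n is Some q then
  (if pselect (S q !=set0) is left h then sval (cid h) else b0) else b0.
exists b.
  move=> n; rewrite /b; case: unpickle => // q.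
  by case: pselect => // h; case: (cid h) => ? [].
move=> c e Bc e0.
have [k ke] : exists k, (k.+1%:R^-1 : R) < e / 2.
  have [k _ /(_ _ (leqnn k)) H] :=
    near_infty_natSinv_lt (PosNum (divr_gt0 e0 (ltr0n R 2))).
  by exists k.
have k0 : 0 < (k.+1%:R^-1 : R) by rewrite invr_gt0.
(* The radius uses [k.+2], not [k.+1]: the maximum over coordinates keeps only a weak inequality,
   and a strict one against [k.+1] is needed. *)
have rq (i : 'I_d) : exists q : rat, `|c ord0 i - ratr q| < k.+2%:R^-1.
  have [|q] := @rat_in_itvoo R (c ord0 i) (c ord0 i + k.+2%:R^-1).
    by rewrite ltrDl invr_gt0.
  rewrite in_itv/= => /andP[q1 q2]; exists q.
  by rewrite distrC gtr0_norm ?subr_gt0// ltrBlDl.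
have [f fP] := choice rq.
pose q : Q := (\row_i f i, k).
have cq : `|map_mx ratr q.1 - c| < k.+1%:R^-1.
  rewrite (@le_lt_trans _ _ k.+2%:R^-1)//; last first.
    by rewrite ltf_pV2 ?posrE// ltr_nat.
  apply: rV_norm_le => [|i]; first by rewrite invr_ge0.
  by rewrite !mxE distrC ltW.
exists (pickle q); rewrite /b pickleK.
case: pselect => [h|[]]; last by exists c.
case: (cid h) => z [_ /= qz].
rewrite (splitr e) -(subrK (map_mx ratr q.1) c) -addrA.
rewrite (le_lt_trans (ler_normD _ _))// ltrD//; last exact: lt_trans ke.
by rewrite distrC (lt_trans cq).
Qed.

(* Taking the first admissible term of a dense sequence makes the choice
   measurable. *)
Lemma measurable_nearby_point (e : measure_display) (T : measurableType e) B
    (phi : T -> 'rV[R]_d) (r : T -> R) :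
  measurable_fun setT phi -> measurable_fun setT r ->
  exists2 g : T -> 'rV[R]_d, measurable_fun setT g &
    forall t c, B c -> `|phi t - c| < r t -> B (g t) /\ `|phi t - g t| < r t.
Proof.
move=> mphi mr; have [B0|/set0P/rV_separable[b Bb db]] := eqVneq B set0.
  by exists (cst 0) => // t c; rewrite B0.
pose F n := [set t | `|phi t - b n| < r t].
have mF n : measurable (F n).
  have := measurable_fun_ltr _ mr => /(_ (fun t => `|phi t - b n|)) mlt.
  have -> : F n = setT `&` (fun t => `|phi t - b n| < r t) @^-1` [set true].
    by rewrite setTI.
  apply: mlt => //.
  exact: measurableT_comp (measurable_dist_rV (b n)) mphi.
pose N t := if pselect (exists n, `[<F n t>]) is left h then ex_minn h else 0%N.
have mN k : measurable (N @^-1` [set k]).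
  have mC : measurable (~` \bigcup_n F n).
    by apply: measurableC; exact: bigcupT_measurable.
  (* First index [k] means lying in [F k] and in no earlier [F j]; the default value 0 of [N] adds
     to level 0 the points in no [F n]. *)
  have -> : N @^-1` [set k] = seqDU F k `|`
      (if k == 0%N then ~` \bigcup_n F n else set0).
    rewrite /seqDU; apply/seteqP; split => t /=; rewrite /N.
      case: pselect => [h|nh].
        case: ex_minnP => n /asboolP Fn nmin nk; subst n; left; split => //.
        rewrite -bigcup_mkord => -[j/= jk Fj].
        by have := nmin j (asboolT Fj); rewrite leqNgt jk.
      move=> <-; right; rewrite eqxx => -[n _ Fn]; apply: nh; exists n.
      exact/asboolP.
    case.
      move=> [Fk nF]; case: pselect => [h|nh]; last first.
        by exfalso; apply: nh; exists k; exact/asboolP.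
      case: ex_minnP => n /asboolP Fn nmin; apply/eqP.
      rewrite eqn_leq nmin ?andTb; last exact/asboolP.
      rewrite leqNgt; apply/negP => nk; apply: nF; rewrite -bigcup_mkord.
      by exists n.
    case: eqP => // -> nF; case: pselect => // h; have [n /asboolP Fn] := h.
    by exfalso; apply: nF; exists n.
  by apply: measurableU; [exact: seqDU_measurable|case: ifP].
exists (b \o N).
  move=> _ A mA; rewrite setTI.
  have -> : (b \o N) @^-1` A = \bigcup_(n in [set n | A (b n)]) N @^-1` [set n].
    by apply/seteqP; split => t /=; [exists (N t)|move=> [n/= An ->]].
  exact: bigcup_measurable.
move=> t c Bc ct.
(* The inequality being strict, this slack makes a term of the dense sequence close enough to [c]
   admissible as well. *)
have ct0 : 0 < r t - `|phi t - c| by rewrite subr_gt0.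
have [n cn] := db c _ Bc ct0.
have Fn : F n t.
  rewrite /F/= -(subrK c (phi t)) -addrA (le_lt_trans (ler_normD _ _))//.
  by rewrite -ltrBrDl.
split; first exact: Bb.
rewrite /= /N; case: pselect => [h|[]]; last by exists n; exact/asboolP.
by case: ex_minnP => k /asboolP.
Qed.

End boundary.

(** * Real inequalities for the displacement and the cost *)

Section inequalities.
Variable R : realType.

(* If max m m' <= 2 * min m m' the bound 2 * r is the good one, otherwise
   the trivial bound 2 * D is. *)
Lemma gap_le (m m' D u r : R) : 0 <= D -> u <= 2 * D -> u <= 2 * r ->
  r * Num.min m m' <= `|m - m'| * D -> 0 < m -> 0 < m' ->
  u <= 4 * D * (`|m - m'| / Num.max m m').
Proof.
move=> D0 uD ur rD m0 m'0.
rewrite mulrA ler_pdivlMr; last by rewrite lt_max m0.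
wlog mm' : m m' m0 m'0 rD / m' <= m.
  move=> H; have /orP[] := le_total m' m; first exact: H.
  by move=> h; rewrite maxC distrC; apply: H; rewrite // minC distrC.
move: rD; rewrite max_l// min_r// ger0_norm ?subr_ge0// => rD.
by have [?|?] := lerP m (2 * m'); nra.
Qed.

(** With [s = m / m'] one has [|s - 1| * m' = |m - m'|]. A bound on the start [t] is combined with
    [min <= m'], a bound on the arrival [s * t] with [min <= m = s * m']. *)
Lemma stretch_gap_le (m m' D t : R) : 0 < m -> 0 < m' ->
  `|t| <= D \/ `|(m / m') * t| <= D ->
  `|m / m' - 1| * `|t| * Num.min m m' <= `|m - m'| * D.
Proof.
move=> m0 m'0 tD.
have sE : `|m / m' - 1| * m' = `|m - m'|.
  have -> : m - m' = (m / m' - 1) * m' by field; rewrite gt_eqF.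
  by rewrite normrM (gtr0_norm m'0).
case: tD => [tD|].
  apply: (@le_trans _ _ (`|m / m' - 1| * `|t| * m')).
    by rewrite ler_wpM2l ?mulr_ge0// ge_min lexx orbT.
  by rewrite mulrAC sE ler_wpM2l.
rewrite normrM gtr0_norm ?divr_gt0// => tD.
apply: (@le_trans _ _ (`|m / m' - 1| * `|t| * m)).
  by rewrite ler_wpM2l ?mulr_ge0// ge_min lexx.
have -> : `|m / m' - 1| * `|t| * m = `|m - m'| * (m / m' * `|t|).
  by rewrite -sE; field; rewrite gt_eqF.
by rewrite ler_wpM2l.
Qed.

(** The mass factor satisfies [m + m' <= 2 * Num.max m m'], and this one power of the maximum turns
    the exponent [p] of the denominator into [p - 1]. *)
Lemma powR_cost_le (m m' D p k : R) (d : nat) : 0 < m -> 0 < m' -> 0 <= D ->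
  1 <= p -> 0 <= k ->
  (k * (4 * D * (`|m - m'| / Num.max m m'))) `^ p * ((m + m') * (2 * D) ^+ d) <=
  (2 * 2 ^+ d * (4 * k) `^ p) * D `^ (p + d%:R) *
    (`|m - m'| `^ p / Num.max m m' `^ (p - 1)).
Proof.
move=> m0 m'0 D0 p1 k0; set M := Num.max m m'; set G := `|m - m'|.
have M0 : 0 < M by rewrite lt_max m0.
have G0 : 0 <= G by exact: normr_ge0.
have p0 : 0 < p by exact: lt_le_trans p1.
have -> : k * (4 * D * (G / M)) = (4 * k) * D * (G * M^-1) by ring.
rewrite !powRM ?mulr_ge0 ?invr_ge0 ?(ltW M0)//.
have -> : D `^ (p + d%:R) = D `^ p * D ^+ d.
  rewrite powRD ?powR_mulrn//.
  by rewrite gt_eqF// ltr_wpDr.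
have -> : (M `^ (p - 1))^-1 = M * M^-1 `^ p.
  rewrite -powRN opprB powRD; last by rewrite (gt_eqF M0) implybT.
  by rewrite powRr1 ?ltW// -(@powR_inv1 _ M) ?ltW// -powRrM mulN1r.
rewrite exprMn.
have mM : m + m' <= 2 * M.
  by rewrite mulrDl !mul1r lerD// le_max lexx ?orbT.
pose Q := 4 `^ p * k `^ p * D `^ p * (G `^ p * M^-1 `^ p) * (2 ^+ d * D ^+ d).
rewrite [leLHS](_ : _ = Q * (m + m')); last by rewrite /Q; ring.
rewrite [leRHS](_ : _ = Q * (2 * M)); last by rewrite /Q; ring.
by rewrite ler_wpM2l// !mulr_ge0 ?powR_ge0 ?exprn_ge0.
Qed.

End inequalities.

(** * The map sending a point to its corrected pair of endpoints *)

Section exit_plan.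
Variables (R : realType) (d : nat) (U : set 'rV[R]_d.+1) (oU : open U).
Variables (a s : R).

Let T := stretch R d a s.
Let rho (x : 'rV[R]_d.+1) : R := `|s - 1| * `|x ord0 ord0 - a|.

Lemma stretch_dist x : `|x - T x| <= rho x.
Proof.
have r0 : 0 <= rho x by rewrite mulr_ge0.
apply: rV_norm_le => // i; rewrite !mxE.
case: eqP => [->|_]; last by rewrite subrr normr0.
rewrite /rho -normrM -normrN le_eqVlt; apply/orP; left; apply/eqP.
by congr `| _ |; ring.
Qed.

(** An endpoint outside [U] is replaced by a measurably chosen point of [closure U] that is also
    outside [U]. Neither belongs to any subset of [U], so the replacement is invisible to the
    marginals on [U]. *)
Lemma stretch_map_pair : exists2 h : 'rV[R]_d.+1 -> 'rV[R]_d.+1 * 'rV[R]_d.+1,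
  measurable_fun setT h &
  forall x, (U `|` T @^-1` U) x ->
    [/\ (closure U `*` closure U) (h x), `|(h x).1 - (h x).2| <= 2 * rho x,
        forall A, A `<=` U -> A (h x).1 <-> A x &
        forall A, A `<=` U -> A (h x).2 <-> A (T x)].
Proof.
have mT : measurable_fun setT T by exact: measurable_stretch.
have mrho : measurable_fun setT (fun x => 2 * rho x).
  apply: measurable_funM => //; apply: measurable_funM => //.
  apply: (measurableT_comp (@normr_measurable R setT)).
  by apply: measurable_funB => //; exact: measurable_rV_coord.
have mU : measurable U by exact: open_measurable_rV.
have mem_mfun (phi : 'rV[R]_d.+1 -> 'rV[R]_d.+1) : measurable_fun setT phi ->
    measurable_fun setT (fun x => phi x \in U).
  move=> mphi; apply: (measurable_fun_bool true).
  rewrite (_ : _ @^-1` _ = phi @^-1` U); first exact: mphi.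
  by apply/seteqP; split => x /= => [/set_mem|/mem_set].
(* [gx] stays near [x] and replaces [T x]; [gy] stays near [T x] and replaces [x]. *)
have [gx mgx gxP] := measurable_nearby_point R d.+1 _ _ (closure U `\` U)
  id _ (@measurable_id _ _ _) mrho.
have [gy mgy gyP] := measurable_nearby_point R d.+1 _ _ (closure U `\` U)
  T _ mT mrho.
pose f x := if x \in U then x else gy x.
pose g x := if T x \in U then T x else gx x.
(* The factor 2 buys the strict inequality that the selection needs. It can fail only when
   [x = T x], and then [U] contains both endpoints or neither, so nothing has to be replaced by a
   nearby point. *)
have rho_lt x : x <> T x -> `|x - T x| < 2 * rho x.
  move=> xT; have : 0 < `|x - T x| by rewrite normr_gt0 subr_eq0; apply/eqP.
  have := stretch_dist x; lra.
exists (fun x => (f x, g x)).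
  apply: measurable_fun_pair.
    by apply: measurable_fun_ifT => //; exact: (mem_mfun id).
  by apply: measurable_fun_ifT => //; exact: mem_mfun.
have bdry A z x : A `<=` U -> (closure U `\` U) z -> ~ U x -> A z <-> A x.
  by move=> AU [_ nUz] nUx; split => [/AU|/AU].
have subU x : U x -> closure U x by exact: subset_closure.
have rho0 x : 0 <= rho x by rewrite mulr_ge0.
move=> x; rewrite /f/g/=; case: ifPn => [/set_mem Ux|/negP nUx];
  case: ifPn => [/set_mem UTx|/negP nUTx].
- move=> _; split => //=; first by split; exact: subU.
  by have := stretch_dist x; have := rho0 x; lra.
- have {}nUTx : ~ U (T x) by move=> ?; apply: nUTx; exact: mem_set.
  move=> _; have [c cB xc] := exists_boundary_point R d.+1 _ _ _ oU Ux nUTx.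
  have [gB xg] : (closure U `\` U) (gx x) /\ `|x - gx x| < 2 * rho x.
    apply: (gxP x c) => //; apply: le_lt_trans xc (rho_lt _ _).
    by move=> xT; rewrite -xT in nUTx.
  split => //=; [by split; [exact: subU|case: gB]|exact: ltW|].
  by move=> A AU; exact: bdry.
- have {}nUx : ~ U x by move=> ?; apply: nUx; exact: mem_set.
  move=> _; have [c cB xc] := exists_boundary_point R d.+1 _ _ _ oU UTx nUx.
  have [gB xg] : (closure U `\` U) (gy x) /\ `|T x - gy x| < 2 * rho x.
    apply: (gyP x c) => //; apply: le_lt_trans xc _; rewrite distrC.
    by apply: rho_lt => xT; rewrite -xT in UTx.
  split => //=; [by split; [case: gB|exact: subU]|by rewrite distrC ltW|].
  by move=> A AU; exact: bdry.
- by case=> [/mem_set//|/mem_set].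
Qed.

End exit_plan.

(** * Cost of a plan with bounded displacement, and conclusion *)

Lemma transport_cost_le (R : realType) (d : nat) (p K : R) (U : set 'rV[R]_d)
    (pi : {measure set ('rV[R]_d * 'rV[R]_d) -> \bar R}) : 0 <= p -> 0 <= K ->
  pi [set z | K `^ p < eucl_norm (z.1 - z.2) `^ p] = 0%E ->
  (transport_cost p U pi <= (K `^ p)%:E * pi setT)%E.
Proof.
move=> p0 K0 piK; rewrite /transport_cost.
have mc := measurable_eucl_dist_powR R d p.
have mcl : measurable (closure U).
  rewrite -(setCK (closure U)); apply: measurableC; apply: open_measurable_rV.
  by rewrite openC; exact: closed_closure.
have mcU : measurable (closure U `*` closure U) by exact: measurableX.
apply: (@le_trans _ _ ((K `^ p)%:E * pi (closure U `*` closure U))%E);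
    last first.
  rewrite lee_wpmul2l ?lee_fin ?powR_ge0//.
  by apply: le_measure; rewrite ?inE.
rewrite -integral_cst//; apply: ae_ge0_le_integral => //.
- by move=> z _; rewrite lee_fin powR_ge0.
- apply: measurable_funTS; exact/measurable_EFinP.
- by move=> z _; rewrite lee_fin powR_ge0.
- exists [set z | K `^ p < eucl_norm (z.1 - z.2) `^ p]; split => //.
    rewrite -[X in measurable X]setTI.
    have mlt := measurable_fun_ltr (measurable_cst (K `^ p)) mc.
    exact: (mlt measurableT [set true]).
  move=> z /= nz; rewrite ltNge; apply/negP => cz; apply: nz => _.
  by rewrite lee_fin.
Qed.

Theorem lemma2p5 (R : realType) (d : nat) (p : R)
    (hd : (1 <= d)%N) (hp : 1 <= p) :
  exists C : R, 0 < C /\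
    forall (Omega : set 'rV[R]_d) (oOmega : open Omega),
      bounded_set Omega ->
      forall (m m' : R) (hm : 0 < m) (hm' : 0 < m'),
        (Wb_pow p Omega
           (constant_density oOmega (NngNum (ltW hm)))
           (constant_density oOmega (NngNum (ltW hm')))
         <= (C * diam Omega `^ (p + d%:R) *
             (`|m - m'| `^ p / Num.max m m' `^ (p - 1)))%:E)%E.
Proof.
(* A positive dimension provides the coordinate to be stretched. *)
case: d hd => // d _.
pose k : R := Num.sqrt d.+1%:R.
have k0 : 0 < k by rewrite sqrtr_gt0 ltr0n.
have p0 : 0 <= p by rewrite (le_trans _ hp).
(* The first 2 bounds [m + m'] by the maximum, [2 ^+ d.+1] comes from a cube of side [2 * D], and
   [4 * k] joins the constant of [gap_le] to the passage from sup to Euclidean norm. *)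
exists (2 * 2 ^+ d.+1 * (4 * k) `^ p); split.
  by rewrite !mulr_gt0// ?exprn_gt0// powR_gt0 ?mulr_gt0.
move=> U oU bU m m' m0 m'0; rewrite /Wb_pow.
have mU := open_measurable_rV oU.
have [U0|/set0P[x0 Ux0]] := eqVneq U set0.
  (* The empty set offers no centre [x0]; there the zero measure is a plan of cost 0. *)
  apply: (@le_trans _ _ (transport_cost p U mzero)).
    apply: ereal_inf_lbound; exists mzero => //; split => // A mA AU.
      have -> : A = set0 by apply/seteqP; split => //; rewrite -U0.
      by rewrite /pushforward measure0.
    have -> : A = set0 by apply/seteqP; split => //; rewrite -U0.
    by rewrite /pushforward measure0.
  rewrite /transport_cost integral_measure_zero lee_fin.
  by rewrite !mulr_ge0// ?exprn_ge0// ?invr_ge0 ?powR_ge0.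
pose D := diam U; pose s := m / m'; pose a := x0 ord0 ord0.
have s0 : 0 < s by rewrite divr_gt0.
pose T := stretch R d a s.
have UD x : U x -> `|x - x0| <= D by move=> Ux; exact: norm_le_diam.
have D0 : 0 <= D by have := UD _ Ux0; rewrite subrr normr0.
have clD := closure_norm_le R d.+1 U x0 D UD.
have [h mh hP] := stretch_map_pair R d U oU a s.
pose V := U `|` T @^-1` U.
have mTU : measurable (T @^-1` U).
  by rewrite -[X in measurable X]setTI; exact: measurable_stretch.
have mV : measurable V by exact: measurableU.
set leb := lebesgue_rV R d.+1.
pose pi := image_measure (mscale (NngNum (ltW m0)) (mrestr leb mV)) mh.
have piE A : pi A = (m%:E * leb (h @^-1` A `&` V))%E by [].
(* This identity dictates [s = m / m']; both the second marginal and the total mass rest on it. *)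
have lebTU A : measurable A -> (m%:E * leb (T @^-1` A) = m'%:E * leb A)%E.
  move=> mA; rewrite lebesgue_rV_stretch// muleA -EFinM; congr (_%:E * _)%E.
  by rewrite /s; field; rewrite !gt_eqF.
pose g := `|m - m'| / Num.max m m'.
pose K := k * (4 * D * g).
have g0 : 0 <= g by rewrite divr_ge0// le_max (ltW m0).
have K0 : 0 <= K by rewrite mulr_ge0 ?(ltW k0)// mulr_ge0// mulr_ge0.
have hK x : V x -> eucl_norm ((h x).1 - (h x).2) <= K.
  move=> Vx; have [[c1 c2] hr _ _] := hP x Vx.
  apply: le_trans (eucl_norm_le _ _ _) _; rewrite ler_pM2l//.
  apply: gap_le hr _ _ _ => //.
    (* The trivial bound [2 * D] goes through [x0]: both endpoints, even on the boundary, are within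
       [D] of it. *)
    rewrite -(subrK x0 (h x).1) -addrA (le_trans (ler_normD _ _))//.
    rewrite mulrDl !mul1r lerD ?clD// distrC clD//.
  (* Here [t] is the first coordinate relative to that of [x0], so [x] in [U] bounds [t] and [T x]
     in [U] bounds [s * t]. *)
  apply: stretch_gap_le => //; case: Vx => [Ux|UTx]; [left|right].
    have := norm_coord_le _ _ (x - x0) ord0; rewrite !mxE.
    by move=> /le_trans; apply; exact: UD.
  have := norm_coord_le _ _ (T x - x0) ord0.
  rewrite !mxE eqxx -/a addrAC subrr add0r.
  by move=> /le_trans; apply; exact: UD.
have plan : boundary_plan U (constant_density oU (NngNum (ltW m0)))
    (constant_density oU (NngNum (ltW m'0))) pi.
  split.
  - rewrite piE (_ : _ `&` _ = set0) ?measure0 ?mule0//.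
    apply/seteqP; split => // x [nh Vx]; apply: nh.
    by have [] := hP x Vx.
  - move=> A mA AU; rewrite /pushforward piE.
    congr (_ * leb _)%E; apply/seteqP; split => x /=.
      move=> [Ahx Vx]; have [_ _ /(_ A AU) [hA _] _] := hP x Vx.
      by have Ax := hA Ahx; split => //; exact: AU.
    move=> [Ax Ux]; have Vx : V x by left.
    by have [_ _ /(_ A AU) [_ hA] _] := hP x Vx; split => //; exact: hA.
  - move=> A mA AU; rewrite /pushforward piE.
    rewrite [RHS](_ : _ = (m'%:E * leb A)%E); last first.
      by congr (_ * leb _)%E; apply/setIidPl.
    rewrite -lebTU//.
    congr (_ * leb _)%E; apply/seteqP; split => x /=.
      by move=> [Ahx Vx]; have [_ _ _ /(_ A AU) [hA _]] := hP x Vx; exact: hA.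
    move=> Ax; have Vx : V x by right; exact: AU.
    by have [_ _ _ /(_ A AU) [_ hA]] := hP x Vx; split => //; exact: hA.
apply: (@le_trans _ _ (transport_cost p U pi)).
  by apply: ereal_inf_lbound; exists pi.
apply: le_trans (transport_cost_le R d.+1 p K U pi p0 K0 _) _.
  rewrite piE (_ : _ `&` _ = set0) ?measure0 ?mule0//.
  apply/seteqP; split => // x [/= Kx Vx].
  have := hK x Vx; rewrite leNgt => /negP; apply.
  rewrite ltNge; apply/negP => hx; move: Kx; rewrite ltNge => /negP; apply.
  by rewrite ge0_ler_powR// nnegrE sqrtr_ge0.
(* The mass of [pi] is at most [m * leb U + m * leb (T^-1 U) = (m + m') * leb U], and [U] lies in a
   cube of side [2 * D] centred at [x0]. *)
apply: (@le_trans _ _ ((K `^ p)%:E * ((m + m') * (2 * D) ^+ d.+1)%:E)%E).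
  rewrite lee_wpmul2l ?lee_fin ?powR_ge0// piE preimage_setT setTI.
  apply: (@le_trans _ _ (m%:E * (leb U + leb (T @^-1` U)))%E).
    by rewrite lee_wpmul2l ?lee_fin ?(ltW m0)// measureU2.
  rewrite ge0_muleDr// lebTU// -ge0_muleDl ?lee_fin ?(ltW m0) ?(ltW m'0)//.
  rewrite EFinM lee_wpmul2l ?lee_fin ?addr_ge0 ?(ltW m0) ?(ltW m'0)//.
  exact: lebesgue_rV_le_cube UD.
by rewrite -EFinM lee_fin; apply: powR_cost_le => //; exact: ltW.
Qed.
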